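(* Assume that $M$ is a locally right Garside monoid satisfying Condition $(C_3^+)$, with atom set $S$, that $\boldsymbol{M}$ is a dense atomic $n$-covering of $M$ based on $\boldsymbol{g}=(g_\alpha)_{\alpha\in\{1,2\}^n}$, and that the following condition is satisfied: $( * )$ There exists an algorithm that, for $w$ a word on $S$ and $s$ in $S$, runs in time $O(\|w\|)$, recognizes whether $s$ is a right divisor of $\overline{w}$, and, if so, returns a word representing $\overline{w}\,s^{-1}$. Then, for each word $w$ on $S$, the normal form algorithm described in the context, which returns the unique $\boldsymbol{M}$-normal word equivalent to $w$, runs in time $O(\|w\|^2)$ (when its division subroutine is an algorithm as in $( * )$).
   Context: For a monoid $M$ and $x,y\in M$: $y$ is a right divisor of $x$, and $x$ is a left multiple of $y$, if $x=zy$ for some $z\in M$; $y\prec x$ means $x=zy$ for some $z\neq1$. $\mathrm{Div}_R(x)$ is the set of right divisors of $x$. A left lcm of $x,y$ is a common left multiple that is a right divisor of every common left multiple. $M$ is locally right Garside if: $(C_1)$ $M$ is right cancellative; $(C_2)$ any two elements that admit a common left multiple admit a left lcm; $(C_3)$ for every $x$ there is no infinite chain $x_1\prec x_2\prec\cdots$ in $\mathrm{Div}_R(x)$. If $y$ is a right divisor of $x$, $xy^{-1}$ denotes the unique $z$ with $x=zy$. Condition $(C_3^+)$: there exists $\lambda:M\to\mathbb{N}$ such that $y\ne1$ implies $\lambda(xy)\ge\lambda(x)+\lambda(y)>\lambda(x)$. An atom is an element $g\neq1$ such that $g=xy$ implies $x=1$ or $y=1$. For a word $w$ on $S$, $\overline{w}$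 is the element of $M$ it represents, $w(k)$ is its $k$th letter from the right, and $\|w\|$ is the maximal length of a word $w'$ on $S$ with $\overline{w'}=\overline{w}$. Two words are equivalent if they represent the same element. A submonoid $M_1$ of $M$ is closed if every left lcm (in $M$) of elements of $M_1$ and every left divisor (in $M$) of an element of $M_1$ belong to $M_1$. $(M_2,M_1)$ is a covering of $M$ if $M_2,M_1$ are closed submonoids of $M$ whose union generates $M$. An $n$-covering $\boldsymbol{M}$ of $M$ is a family of monoids $M_\alpha$ indexed by the words $\alpha$ over $\{1,2\}$ of length at most $n$ (binary addresses), with $M_\varnothing=M$ and such that, for each $\alpha$ of length $<n$, $(M_{\alpha2},M_{\alpha1})$ is a covering of $M_\alpha$. It is atomic, based on a family $(g_\alpha)_{\alpha\in\{1,2\}^n}$ of atoms of $M$, if $M_\alpha$ is the submonoid generated by $g_\alpha$ for each $\alpha$ of length $n$. It is dense if, for each binary address $\beta$ of length $m$ with $0\le m<n$, $M_\beta$ is generated by $M_{\beta1}\cup M_{\beta21^{n-m-1}}$, and also by $M_{\beta2}\cup M_{\beta1^{n-m}}$. For a binary $n$-address $\alpha=d_1\ldots d_n$ and $0\le m\le n$, the binary $m$-successor $\alpha^{[m]}$ keeps the first $m$ digits, exchanges $1$ and $2$ in the $(m+1)$st digit (if $m<n$), and replaces all subsequent digits by $1$; $\alpha^{[n]}=\alpha$. A length $\ell$ word $w$ on $S$ is $\boldsymbol{M}$-normal if there exist binary $n$-addresses $\alpha_\ell,\ldots,\alpha_0$ with $\alpha_0=1^n$ such that, for $1\le k\le\ell$,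 $w(k)=g_{\alpha_k}$, where $\alpha_k$ is $\alpha_{k-1}^{[m]}$ with maximal $m$ such that $g_{\alpha_{k-1}^{[m]}}$ is a right divisor of $\overline{w(\ell)\ldots w(k)}$. The algorithm: let $\mathrm{quotient}(w,g)$ be a subroutine that, for $w$ a word on $S$ and $g\in S$, returns an error if $g$ is not a right divisor of $\overline{w}$, and a word representing $\overline{w}g^{-1}$ otherwise. On input $w$, start with $w'$ the empty word and $\alpha=1^n$. While $w$ is not empty: set $m=n$; while $\mathrm{quotient}(w,g_{\alpha^{[m]}})$ is an error, decrease $m$ by $1$; then replace $\alpha$ by $\alpha^{[m]}$, replace $w$ by $\mathrm{quotient}(w,g_\alpha)$ (for the new $\alpha$), and add the letter $g_\alpha$ on the left of $w'$. Output $w'$. *)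

(* Defs.v *)
From HB Require Import structures.
From mathcomp Require Import all_boot.
From mathcomp Require Import boolp classical_sets.

Set Implicit Arguments.
Unset Strict Implicit.
Unset Printing Implicit Defensive.

Local Open Scope classical_set_scope.
Local Open Scope group_scope.

(* Divisibility is defined relatively to a submonoid A of an ambient monoid:
   for x and y in A, these are the notions of the monoid A itself.  The notions
   of M are obtained for A = [set: M]. *)

Definition submonoid (M : monoidType) (A : set M) : Prop :=
  A 1 /\ (forall x y, A x -> A y -> A (x * y)).

Definition rdivides (M : monoidType) (A : set M) (y x : M) : Prop :=
  exists2 z, A z & x = z * y.

Definition sdivides (M : monoidType) (A : set M) (y x : M) : Prop :=
  exists z, [/\ A z, z <> 1 & x = z * y].

Definition left_lcm (M : monoidType) (A : set M) (x y z : M) : Prop :=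
  [/\ A z, rdivides A x z, rdivides A y z &
      forall t, A t -> rdivides A x t -> rdivides A y t -> rdivides A z t].

Record locally_right_garside (M : monoidType) : Prop := LocallyRightGarside {
  garsideC1 : forall x y z : M, x * z = y * z -> x = y;
  garsideC2 : forall x y t : M,
    rdivides [set: M] x t -> rdivides [set: M] y t ->
    exists z, left_lcm [set: M] x y z;
  garsideC3 : forall x : M, ~ exists c : nat -> M, forall i : nat,
    rdivides [set: M] (c i) x /\ sdivides [set: M] (c i) (c i.+1)
}.

Definition condition_C3plus (M : monoidType) : Prop :=
  exists lambda : M -> nat, forall x y : M, y <> 1 ->
    (lambda x + lambda y <= lambda (x * y)%g)%N /\
    (lambda x < lambda x + lambda y)%N.

Definition atom_set (M : monoidType) : set M :=
  [set g | g <> 1 /\ forall x y, g = x * y -> x = 1 \/ y = 1].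
Arguments atom_set : clear implicits.

(* The set S of all atoms, as a type.  Words are read from left to right: the
   head of the list is the leftmost letter. *)
Definition atom (M : monoidType) : Type := atom_set M.
Definition word (M : monoidType) : Type := seq (atom M).

Definition eval (M : monoidType) (w : word M) : M :=
  \big[*%g/1]_(s <- w) val s.

Definition equivalent (M : monoidType) (v w : word M) : Prop :=
  eval v = eval w.

(* ||w||; the maximum exists whenever (C3+) holds. *)
Definition wnorm (M : monoidType) (w : word M) : nat :=
  xget 0%N [set N : nat | (exists2 v : word M, equivalent v w & size v = N) /\
                    forall v : word M, equivalent v w -> (size v <= N)%N].

(* ** Coverings *)

Definition generated (M : monoidType) (G : set M) : set M :=
  smallest (@submonoid M) G.

(* B is a closed submonoid of the monoid A. *)
Record closed_in (M : monoidType) (A B : set M) : Prop := ClosedIn {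
  closed_submonoid : submonoid B;
  closed_sub : B `<=` A;
  closed_lcm : forall x y z, B x -> B y -> left_lcm A x y z -> B z;
  closed_ldiv : forall x y, A x -> A y -> B (x * y) -> B x
}.

Definition covering (M : monoidType) (A B2 B1 : set M) : Prop :=
  [/\ closed_in A B2, closed_in A B1 & generated (B2 `|` B1) = A].

(* Binary addresses are lists of booleans, the digit 1 being [d1] and the digit
   2 being [d2]. *)
Local Notation d1 := false (only parsing).
Local Notation d2 := true (only parsing).
Definition ones (k : nat) : seq bool := nseq k d1.

(* Only the values of the family at addresses of length at most n matter. *)
Definition is_covering (M : monoidType) (n : nat) (Mf : seq bool -> set M)
    : Prop :=
  Mf [::] = [set: M] /\
  forall a : seq bool, (size a < n)%N ->
    covering (Mf a) (Mf (rcons a d2)) (Mf (rcons a d1)).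

Definition atomic_covering (M : monoidType) (n : nat) (Mf : seq bool -> set M)
    (g : n.-tuple bool -> atom M) : Prop :=
  is_covering n Mf /\
  forall a : n.-tuple bool, Mf a = generated [set val (g a)].

Definition dense_covering (M : monoidType) (n : nat) (Mf : seq bool -> set M)
    : Prop :=
  forall b : seq bool, (size b < n)%N ->
    Mf b = generated (Mf (rcons b d1) `|`
                      Mf (rcons b d2 ++ ones (n - size b - 1)%N)) /\
    Mf b = generated (Mf (rcons b d2) `|` Mf (b ++ ones (n - size b)%N)).

(* The m-successor a^[m]. *)
Definition successor (n : nat) (a : n.-tuple bool) (m : nat) : n.-tuple bool :=
  [tuple (if (i < m)%N then tnth a i
          else if i == m :> nat then ~~ tnth a i else d1) | i < n].

(* The k-th letter from the right is [onth (rev w) k.-1], and w(l)...w(k) is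
   the prefix of w of length l - k + 1. *)
Definition normal (M : monoidType) (n : nat) (g : n.-tuple bool -> atom M)
    (w : word M) : Prop :=
  exists a : nat -> n.-tuple bool,
    a 0%N = nseq_tuple n d1 /\
    forall k : nat, (1 <= k <= size w)%N ->
      let divides (m : nat) :=
        rdivides [set: M] (val (g (successor (a k.-1) m)))
                 (eval (take (size w - k + 1)%N w)) in
      onth (rev w) k.-1 = Some (g (a k)) /\
      exists m : nat,
        [/\ (m <= n)%N, a k = successor (a k.-1) m, divides m &
            forall m' : nat, (m < m' <= n)%N -> ~ divides m'].

(* ** Model of computation

   Algorithms are deterministic machines with a finite control and finitely
   many stacks over a finite alphabet A (a multitape Turing machine is the same
   thing, up to constant factors in the running time: each of its tapes is a
   pair of stacks).  They are written as programs: a program in [prog A X]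
   returns a value in X.  Values belong to the finite control; they are never
   unbounded, because when A is finite, as the state of a loop must be, a
   program can only return finitely many different values.

   [Call r p r'] runs p on a fresh memory as a subroutine, with the contents of
   r as its input, and stores its output in r'.  The input of a program is in
   stack 0, all the other stacks being initially empty, and its output is in
   stack 1. *)

Inductive prog (A : Type) : Type -> Type :=
| Ret (X : Type) of X : prog A X
| Bind (X Y : Type) of prog A X & (X -> prog A Y) : prog A Y
| Top of nat : prog A (option A)
| Pop of nat : prog A unit
| Push of nat & A : prog A unit
| Loop (X : finType) (Y : Type) of (X -> prog A (X + Y)) & X : prog A Y
| Call (X : Type) of nat & prog A X & nat : prog A X.

Arguments Ret {A X}.
Arguments Top {A}.
Arguments Pop {A}.

Definition memory (A : Type) : Type := nat -> seq A.

Definition update (A : Type) (s : memory A) (r : nat) (u : seq A) : memory A :=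
  fun i => if i == r then u else s i.

Definition input (A : Type) (u : seq A) : memory A :=
  update (fun=> [::]) 0%N u.

(* Every iteration costs one step, besides the cost of its body. *)
Inductive loop_exec (A X Y : Type)
    (body : X -> memory A -> X + Y -> memory A -> nat -> Prop) :
    X -> memory A -> Y -> memory A -> nat -> Prop :=
| LoopExit x s y s' t :
    body x s (inr y) s' t -> loop_exec body x s y s' t.+1
| LoopNext x s x1 s1 t1 y s' t2 :
    body x s (inl x1) s1 t1 -> loop_exec body x1 s1 y s' t2 ->
    loop_exec body x s y s' (t1 + t2).+1.

(* [exec p s x s' t]: started in s, the program p halts after t steps with
   result x, in the memory s'.  Stack operations take one step; a call is also
   charged for copying its input and its output letter by letter. *)
Fixpoint exec (A X : Type) (p : prog A X) {struct p} :
    memory A -> X -> memory A -> nat -> Prop :=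
  match p in prog _ X return memory A -> X -> memory A -> nat -> Prop with
  | Ret _ x => fun s y s' t => [/\ y = x, s' = s & t = 0%N]
  | Bind _ _ p f => fun s y s' t => exists x s1 t1 t2,
      [/\ exec p s x s1 t1, exec (f x) s1 y s' t2 & t = (t1 + t2)%N]
  | Top r => fun s y s' t => [/\ y = ohead (s r), s' = s & t = 1%N]
  | Pop r => fun s _ s' t => s' = update s r (behead (s r)) /\ t = 1%N
  | Push r a => fun s _ s' t => s' = update s r (a :: s r) /\ t = 1%N
  | Loop _ _ body x => loop_exec (fun x => exec (body x)) x
  | Call _ r p r' => fun s y s' t => exists s1 t1,
      [/\ exec p (input (s r)) y s1 t1, s' = update s r' (s1 1%N) &
          t = (size (s r) + t1 + size (s1 1%N)).+1]
  end.

(* Result, final memory and running time are determined by the program and the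
   initial memory. *)
Lemma exec_functional (A X : Type) (p : prog A X) s x s' t y s'' u :
  exec p s x s' t -> exec p s y s'' u -> [/\ x = y, s' = s'' & t = u].
Proof.
elim: p s x s' t y s'' u => {X} /=.
- by move=> X x0 s x s' t y s'' u [-> -> ->] [-> -> ->].
- move=> X Y p IHp f IHf s x s' t y s'' u.
  move=> [a [sa [ta [tb [pa fa ->]]]]] [b [sb [tc [td [pb fb ->]]]]].
  have [eab esab ->] := IHp _ _ _ _ _ _ _ pa pb.
  rewrite -eab -esab in fb.
  by have [-> -> ->] := IHf _ _ _ _ _ _ _ _ fa fb.
- by move=> r s x s' t y s'' u [-> -> ->] [-> -> ->].
- by move=> r s [] s' t [] s'' u [-> ->] [-> ->].
- by move=> r a s [] s' t [] s'' u [-> ->] [-> ->].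
- move=> X Y body IH z s x s' t y s'' u Hl.
  elim: Hl y s'' u => {z s x s' t}
    [z s x s' t Hb|z s z1 s1 t1 x s' t2 Hb _ IHl] y s'' u H;
    inversion H as [z0 s0 y0 s0' t0 Hb'|z0 s0 z1' s1' t1' y0 s0' t2' Hb' Hl'];
    subst; have [ez es et] := IH _ _ _ _ _ _ _ _ Hb Hb' => //.
  + by case: ez => ->; rewrite es et.
  + case: ez => ez; subst.
    by have [-> -> ->] := IHl _ _ _ Hl'.
- move=> X r p IHp r' s x s' t y s'' u.
  move=> [sa [ta [pa -> ->]]] [sb [tb [pb -> ->]]].
  by have [-> -> ->] := IHp _ _ _ _ _ _ _ pa pb.
Qed.

(* Working alphabet: the letters of S, and auxiliary symbols.  It is finite: in
   the presence of an atomic n-covering, (C3+) forces every atom to be one of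
   the 2^n atoms g_alpha. *)
Definition symbol (M : monoidType) (Gamma : finType) : Type :=
  (atom M + Gamma)%type.

Definition code (M : monoidType) (Gamma : finType) (w : word M) :
    seq (symbol M Gamma) :=
  map inl w.
Arguments code {M} Gamma w.

(* Running times in O(f(w)) are bounded by C * (f(w) + 1), which also covers
   the empty word, for which ||w|| = 0.  The Boolean result is false when an
   error is returned; the subroutine has one version for each letter s. *)
Definition division_algorithm (M : monoidType) (Gamma : finType)
    (quotient : atom M -> prog (symbol M Gamma) bool) : Prop :=
  exists C : nat, forall (w : word M) (s : atom M),
    exists (ok : bool) (mem : memory (symbol M Gamma)) (t : nat),
      [/\ exec (quotient s) (input (code Gamma w)) ok mem t,
          (t <= C * (wnorm w + 1))%N,
          ok <-> rdivides [set: M] (val s) (eval w) &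
          ok -> exists2 v : word M,
            mem 1%N = code Gamma v & eval v * val s = eval w].

Local Notation "'do' x <- p ; q" := (Bind p (fun x => q))
  (at level 200, x name, p at level 100, q at level 200).

(* Stack 0 contains w, stack 1 contains w', and stack 2 is a dummy receiving
   the output of the divisions that are only performed as tests.  When every
   division fails down to m = 0, the behaviour is left unspecified, and
   this program loops forever. *)
Definition normal_form_algorithm (M : monoidType) (Gamma : finType) (n : nat)
    (g : n.-tuple bool -> atom M)
    (quotient : atom M -> prog (symbol M Gamma) bool) :
    prog (symbol M Gamma) unit :=
  Loop (fun alpha : n.-tuple bool =>
    do top <- Top 0;
    if top is None then Ret (inr tt) else
    do m <- Loop (fun m : 'I_n.+1 =>
              do ok <- Call 0 (quotient (g (successor alpha m))) 2;
              Ret (if ok then inr m else inl (inord m.-1))) ord_max;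
    let beta := successor alpha m in
    do _ <- Call 0 (quotient (g beta)) 0;
    do _ <- Push 1 (inl (g beta));
    Ret (inl beta)) (nseq_tuple n d1).

(* Main.v *)
(* Density implies that, for every address [a], the elements [g (a^[m])] with
   [m <= n] generate [M]: so every element [x <> 1] is divisible on the right by
   one of them, and the algorithm never gets stuck.  Each round removes one atom
   from [w], so there are at most [||w||] rounds, each of which makes at most
   [n + 2] calls to the division subroutine.  The normal word is unique because
   the choice of the maximal [m] leaves no freedom and [M] is right
   cancellative. *)

Require Import Defs.
From HB Require Import structures.
From mathcomp Require Import all_boot.
From mathcomp Require Import boolp classical_sets.
From mathcomp Require Import zify.

Set Implicit Arguments.
Unset Strict Implicit.
Unset Printing Implicit Defensive.

Local Open Scope classical_set_scope.
Local Open Scope group_scope.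

(** * Evaluation of words, and the norm under (C3+) *)

Lemma eval_nil (M : monoidType) : eval ([::] : word M) = 1.
Proof. exact: big_nil. Qed.

Lemma eval_rcons (M : monoidType) (w : word M) (s : atom M) :
  eval (rcons w s) = eval w * val s.
Proof. by rewrite /eval big_rcons. Qed.

Lemma atom_neq1 (M : monoidType) (s : atom M) : val s <> 1.
Proof. by case: s => x /= /set_mem [? _]. Qed.

Section Norm.
Variables (M : monoidType) (hC3 : condition_C3plus M).

(** (C3+) applied to [1 * val s] forces [lambda 1 = 0], while [x * val s = 1] would give
    [lambda 1 >= lambda (val s) > 0]. *)
Lemma mul_atom_neq1 (x : M) (s : atom M) : x * val s <> 1.
Proof.
have [lambda hl] := hC3; move=> e.
have := hl x _ (@atom_neq1 _ s); have := hl 1 _ (@atom_neq1 _ s).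
rewrite e mul1g; lia.
Qed.

Lemma eval_eq1 (w : word M) : eval w = 1 -> w = [::].
Proof.
by elim/last_ind: w => // w s _; rewrite eval_rcons => /(@mul_atom_neq1 _ _).
Qed.

(** Each letter raises [lambda] by at least 1, so [lambda (eval w)] bounds the length of every word
    equivalent to [w]. The maximum thus exists, and the default value of [xget] is never taken. *)
Lemma wnorm_spec (w : word M) :
  (exists2 v : word M, equivalent v w & size v = wnorm w) /\
  forall v : word M, equivalent v w -> (size v <= wnorm w)%N.
Proof.
have [lambda hl] := hC3.
have size_le (v : word M) : (size v <= lambda (eval v))%N.
  elim/last_ind: v => // v s IH; rewrite size_rcons eval_rcons.
  have := hl (eval v) _ (@atom_neq1 _ s); lia.
pose P N := `[< exists2 v : word M, equivalent v w & size v = N >].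
have exP : exists N, P N by exists (size w); apply/asboolP; exists w.
have ubP N : P N -> (N <= lambda (eval w))%N.
  by move/asboolP => [v <- <-].
rewrite /wnorm; case: xgetP => [N _ //|/(_ (ex_maxn exP ubP)) []].
case: ex_maxnP => N /asboolP hN maxN; split=> // v evw.
by apply: maxN; apply/asboolP; exists v.
Qed.

Lemma size_wnorm (w : word M) : (size w <= wnorm w)%N.
Proof. exact: (wnorm_spec w).2. Qed.

(** A longest word equivalent to [v], extended by [s], is equivalent to [w]. *)
Lemma wnorm_quotient (w v : word M) (s : atom M) :
  eval v * val s = eval w -> (wnorm v < wnorm w)%N.
Proof.
move=> e; have [[u uv <-] _] := wnorm_spec v.
rewrite -(size_rcons u s); apply: (wnorm_spec w).2.
by rewrite /equivalent eval_rcons uv.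
Qed.

End Norm.

(** * Generated submonoids *)

Section Generation.
Variable M : monoidType.

Lemma generated_submonoid (G : set M) : submonoid (generated G).
Proof.
split=> [B [[]] //|x y Gx Gy B BG].
by have [[_ BM] _] := BG; apply: BM; [exact: Gx|exact: Gy].
Qed.

Lemma generated_min (G B : set M) :
  submonoid B -> G `<=` B -> generated G `<=` B.
Proof. by move=> sB GB x; apply. Qed.

Lemma generated_sub (G : set M) : G `<=` generated G.
Proof. by move=> x Gx B [_]; apply. Qed.

(** The elements that are 1 or have a right divisor in [G] form a submonoid: a product inherits the
    divisor of its right factor or, when that factor is 1, of its left one. *)
Lemma generated_rdiv (G : set M) (x : M) : generated G x -> x <> 1 ->
  exists2 s, G s & rdivides [set: M] s x.
Proof.
move=> Gx; suff: x = 1 \/ exists2 s, G s & rdivides [set: M] s x by case.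
move: x Gx; apply: generated_min.
  split=> [|x y hx [->|[s Gs [z _ ->]]]]; first by left.
    by rewrite mulg1.
  by right; exists s => //; exists (x * z) => //; rewrite mulgA.
by move=> s Gs; right; exists s => //; exists 1 => //; rewrite mul1g.
Qed.

End Generation.

(** * Generation by the successors of an address *)

Section Successors.
Variables (M : monoidType) (n : nat) (Mf : seq bool -> set M).
Variables (g : n.-tuple bool -> atom M).

Lemma successor_id (a : n.-tuple bool) : successor a n = a.
Proof. by apply: eq_from_tnth => i; rewrite tnth_mktuple ltn_ord. Qed.

(** This is the form in which successors appear in the density condition, with [take m a] as the
    address [b]. *)
Lemma val_successor (a : n.-tuple bool) (m : nat) : (m < n)%N ->
  successor a m = rcons (take m a) (~~ nth false a m) ++ ones (n - m - 1)%N
    :> seq bool.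
Proof.
move=> mn.
have szt : size (take m a) = m by rewrite size_take size_tuple mn.
have sz : size (rcons (take m a) (~~ nth false a m) ++ ones (n - m - 1)%N) = n.
  rewrite size_cat size_rcons szt size_nseq; lia.
apply: (@eq_from_nth _ false) => [|i]; rewrite size_tuple // => lin.
rewrite -[i]/(val (Ordinal lin)) -tnth_nth tnth_mktuple /=.
rewrite nth_cat size_rcons szt nth_rcons szt nth_nseq if_same (tnth_nth false) /=.
case: (ltngtP i m) => im /=.
- by rewrite ltnS ltnW // nth_take.
- by rewrite ltnS leqNgt im.
- by rewrite im ltnS leqnn.
Qed.

Hypotheses (hatomic : atomic_covering Mf g) (hdense : dense_covering n Mf).

(** One climbs from the leaf [a] to the root. At the prefix of length [m], density generates the
    submonoid from the child on the path to [a] and from the leaf [successor a m]. *)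
Lemma generated_successors (a : n.-tuple bool) :
  [set: M] = generated [set val (g (successor a m)) | m in [set m | (m <= n)%N]].
Proof.
have [[M0 _] Ma] := hatomic.
set G := [set _ | _ in _].
have Gs m : (m <= n)%N -> generated G (val (g (successor a m))).
  by move=> mn; apply: generated_sub; exists m.
suff H k : (k <= n)%N -> Mf (take (n - k)%N a) `<=` generated G.
  apply/seteqP; split=> // x _; apply: (H n) => //.
  by rewrite subnn take0 M0.
elim: k => [_|k IH kn].
  rewrite subn0 take_oversize ?size_tuple // Ma.
  apply: generated_min; first exact: generated_submonoid.
  by move=> _ ->; rewrite -[a in g a]successor_id; apply: Gs.
set m := (n - k.+1)%N; have mn : (m < n)%N by rewrite /m; lia.
have {}IH : Mf (rcons (take m a) (nth false a m)) `<=` generated G.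
  rewrite -take_nth ?size_tuple //.
  by rewrite (_ : m.+1 = n - k)%N; [apply: IH; lia|rewrite /m; lia].
have szt : size (take m a) = m by rewrite size_take size_tuple mn.
have HS : Mf (successor a m) `<=` generated G.
  rewrite Ma; apply: generated_min; first exact: generated_submonoid.
  by move=> _ ->; apply: Gs; apply: ltnW.
have := val_successor a mn.
have := @hdense (take m a); rewrite szt => /(_ mn) [D1 D2].
(* The digit of [a] at [m] selects the clause of density: the second one for digit 2, the first one
   for digit 1. *)
case am: (nth false a m) IH => IH eS.
- rewrite D2; apply: generated_min; first exact: generated_submonoid.
  rewrite subUset; split=> //.
  rewrite (_ : n - m = (n - m - 1).+1)%N; last by lia.
  by move: HS; rewrite eS cat_rcons.
- rewrite D1; apply: generated_min; first exact: generated_submonoid.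
  by rewrite subUset; split=> //; rewrite -eS.
Qed.

Lemma successor_rdiv (a : n.-tuple bool) (x : M) : x <> 1 ->
  exists2 m : nat, (m <= n)%N & rdivides [set: M] (val (g (successor a m))) x.
Proof.
move=> x1; suff /generated_rdiv /(_ x1) [_ [m mn <-] d] : generated
    [set val (g (successor a m)) | m in [set m | (m <= n)%N]] x by exists m.
by rewrite -generated_successors.
Qed.

End Successors.

(** * Normal words and their uniqueness *)

Section Normal.
Variables (M : monoidType) (n : nat) (g : n.-tuple bool -> atom M).

Definition greedy (a b : n.-tuple bool) (x : M) : Prop :=
  let divides (m : nat) := rdivides [set: M] (val (g (successor a m))) x in
  exists m : nat, [/\ (m <= n)%N, b = successor a m, divides m &
                      forall m' : nat, (m < m' <= n)%N -> ~ divides m'].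

(** The starting address is left free for induction on the rightmost letter; at address 1^n this is
    [normal], by conversion. *)
Definition normal_from (a0 : n.-tuple bool) (w : word M) : Prop :=
  exists a : nat -> n.-tuple bool, a 0%N = a0 /\
    forall k : nat, (1 <= k <= size w)%N ->
      onth (rev w) k.-1 = Some (g (a k)) /\
      greedy (a k.-1) (a k) (eval (take (size w - k + 1)%N w)).

Lemma greedy_functional a b b' x : greedy a b x -> greedy a b' x -> b = b'.
Proof.
move=> [m [mn -> dm maxm]] [m' [m'n -> dm' maxm']].
case: (ltngtP m m') => [lt|gt|-> //].
- by case: (maxm m'); rewrite ?lt.
- by case: (maxm' m); rewrite ?gt.
Qed.

Lemma normal_from_nil a : normal_from a [::].
Proof. by exists (fun=> a); split=> // k /=; lia. Qed.

Lemma normal_from_rcons a w s : normal_from a (rcons w s) <->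
  exists b, [/\ s = g b, greedy a b (eval (rcons w s)) & normal_from b w].
Proof.
split=> [[c [c0 hc]]|[b [-> gab [c [c0 hc]]]]].
  exists (c 1%N).
  have /hc : (1 <= 1 <= size (rcons w s))%N by rewrite size_rcons.
  rewrite rev_rcons c0 => -[[->] gr]; split=> //.
    by move: gr; rewrite take_oversize //; lia.
  exists (fun k => c k.+1); split=> // -[//|k] kw.
  have /hc : (1 <= k.+2 <= size (rcons w s))%N by rewrite size_rcons; lia.
  rewrite rev_rcons /= size_rcons -cats1 takel_cat; last by lia.
  by rewrite (_ : (size w).+1 - k.+2 = size w - k.+1)%N; last lia.
(* The address sequence is shifted by one, with [a] put in front; the prefixes for [k >= 2] do not
   contain the last letter. *)
exists (fun k => if k is k'.+1 then c k' else a); split=> // -[//|k] kw.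
rewrite size_rcons in kw *; rewrite rev_rcons.
case: k kw => [|k] kw /=.
  by rewrite c0 take_oversize ?size_rcons; last lia.
rewrite -cats1 takel_cat; last by lia.
by rewrite (_ : (size w).+1 - k.+2 = size w - k.+1)%N; [apply: (hc k.+1); lia|lia].
Qed.

(** Equivalent words have the same greedy address at their right end, hence the same last letter,
    which right cancellation removes. *)
Lemma normal_from_unique a (w w' : word M) :
  (forall x y z : M, x * z = y * z -> x = y) -> condition_C3plus M ->
  normal_from a w -> normal_from a w' -> equivalent w w' -> w = w'.
Proof.
move=> cancel hC3; elim/last_ind: w a w' => [|w s IH] a w' nw nw' e.
  by rewrite (@eval_eq1 _ hC3 w') // -e eval_nil.
elim/last_ind: w' nw' e => [_ e|w' s' _ nw' e].
  by apply: eval_eq1 => //; rewrite e eval_nil.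
move: nw nw' e => /normal_from_rcons [b [-> gb nw]].
move=> /normal_from_rcons [b' [-> gb' nw']]; rewrite /equivalent => e.
rewrite e in gb; have eb := greedy_functional gb gb'; subst b'.
move: e; rewrite !eval_rcons => /cancel e.
by rewrite (IH _ _ nw nw' e).
Qed.

End Normal.

(* A failed division may leave anything in its output stack, which [Call] still
   charges for: this bounds it by the running time. *)
Lemma exec_size (A X : Type) (p : prog A X) s x s' t :
  exec p s x s' t -> forall r, (size (s' r) <= size (s r) + t)%N.
Proof.
elim: p s x s' t => {X} /=.
- by move=> X x s y s' t [_ -> ->] r; lia.
- move=> X Y p IHp f IHf s y s' t [x [s1 [t1 [t2 [e1 e2 ->]]]]] r.
  have := IHp _ _ _ _ e1 r; have := IHf _ _ _ _ _ e2 r; lia.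
- by move=> r s x s' t [_ -> ->] i; lia.
- move=> r s x s' t [-> ->] i; rewrite /update; case: eqP => [->|_]; last lia.
  by rewrite size_behead; lia.
- move=> r a s x s' t [-> ->] i; rewrite /update; case: eqP => [->|_] /=; lia.
- move=> X Y body IH z s x s' t; elim=> {z s x s' t}.
    move=> z s x s' t hb r; have := IH _ _ _ _ _ hb r; lia.
  move=> z s z1 s1 t1 x s' t2 hb _ IHl r.
  have := IH _ _ _ _ _ hb r; have := IHl r; lia.
- move=> X r p _ r' s x s' t [s1 [t1 [_ -> ->]]] i.
  rewrite /update; case: eqP => [_|_]; lia.
Qed.

(** * Correctness and running time of the algorithm *)

Section Algorithm.
Variables (M : monoidType) (n : nat) (g : n.-tuple bool -> atom M).
Variables (Gamma : finType) (quotient : atom M -> prog (symbol M Gamma) bool).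
Hypothesis hC3 : condition_C3plus M.
Hypothesis hdiv : forall (a : n.-tuple bool) (x : M), x <> 1 ->
  exists2 m : nat, (m <= n)%N & rdivides [set: M] (val (g (successor a m))) x.
Variable C : nat.
Hypothesis hC : forall (w : word M) (s : atom M),
  exists (ok : bool) (mem : memory (symbol M Gamma)) (t : nat),
    [/\ exec (quotient s) (input (code Gamma w)) ok mem t,
        (t <= C * (wnorm w + 1))%N,
        ok <-> rdivides [set: M] (val s) (eval w) &
        ok -> exists2 v : word M,
          mem 1%N = code Gamma v & eval v * val s = eval w].

(** A call copies at most [wnorm w] letters in, runs for at most [C * (wnorm w + 1)] steps, and
    copies out at most as many letters as it ran steps. *)
Let cost (w : word M) : nat := ((2 * C + 2) * (wnorm w + 1))%N.

Lemma exec_call_quotient (w : word M) (a : atom M) (r : nat)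
    (s : memory (symbol M Gamma)) : s 0%N = code Gamma w ->
  exists (ok : bool) (u : seq (symbol M Gamma)) (t : nat),
    [/\ exec (Call 0 (quotient a) r) s ok (update s r u) t,
        (t <= cost w)%N,
        ok <-> rdivides [set: M] (val a) (eval w) &
        ok -> exists2 v : word M, u = code Gamma v & eval v * val a = eval w].
Proof.
move=> s0; have [ok [mem [t [ex lt dv hv]]]] := hC w a.
exists ok, (mem 1%N), (size (s 0%N) + t + size (mem 1%N)).+1.
split=> //=; first by exists mem, t; rewrite s0.
have := exec_size ex 1%N; rewrite /input /update /= s0 size_map.
have := size_wnorm hC3 w; rewrite /cost; nia.
Qed.

Definition test_loop (a : n.-tuple bool) :
    'I_n.+1 -> prog (symbol M Gamma) 'I_n.+1 :=
  Loop (fun m : 'I_n.+1 =>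
    Bind (Call 0 (quotient (g (successor a m))) 2) (fun ok =>
    Ret (if ok then inr m else inl (inord m.-1)))).

(** Induction on the starting index: a failed test excludes [m0] as a divisor index, so the assumed
    one lies below. Tests write to stack 2 only, so [w] survives in stack 0. *)
Lemma exec_test_loop (w : word M) (a : n.-tuple bool) (m0 : 'I_n.+1)
    (s : memory (symbol M Gamma)) :
  s 0%N = code Gamma w ->
  (exists2 m : nat, (m <= m0)%N &
     rdivides [set: M] (val (g (successor a m))) (eval w)) ->
  exists (m : 'I_n.+1) (u : seq (symbol M Gamma)) (t : nat),
    [/\ exec (test_loop a m0) s m (update s 2 u) t,
        (t <= m0.+1 * (cost w).+1)%N,
        rdivides [set: M] (val (g (successor a m))) (eval w) &
        forall m' : nat, (m < m' <= m0)%N ->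
          ~ rdivides [set: M] (val (g (successor a m'))) (eval w)].
Proof.
case: m0 => m0 lm0; elim: m0 lm0 s => [|m0 IH] lm0 s s0 [m mm0 dm];
  have [ok [u [t [ex lt okP _]]]] :=
    exec_call_quotient (g (successor a (Ordinal lm0))) 2 s0;
  case: ok ex okP => ex okP.
- exists (Ordinal lm0), u, t.+1; split; [|lia|by apply/okP|by move=> m' /=; lia].
  by apply: LoopExit; exists true, (update s 2 u), t, 0%N; split; rewrite ?addn0.
(* Failure at index 0 contradicts the existence of a divisor index. *)
- by move: mm0 dm; rewrite /= leqn0 => /eqP -> /okP.
- exists (Ordinal lm0), u, t.+1.
  split; [|rewrite /=; nia|by apply/okP|by move=> m' /=; lia].
  by apply: LoopExit; exists true, (update s 2 u), t, 0%N; split; rewrite ?addn0.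
- have lm0' : (m0 < n.+1)%N by lia.
  have mne : m <> m0.+1 by move=> e; move: dm; rewrite e => /okP.
  have [||m1 [u1 [t1 [ex1 lt1 dm1 maxm1]]]] := IH lm0' (update s 2 u).
  + by [].
  + by exists m => //=; move: mm0 => /=; lia.
  have eup : update (update s 2 u) 2 u1 = update s 2 u1.
    by apply: funext => i; rewrite /update; case: eqP.
  exists m1, u1, (t + t1).+1; split=> //; last first.
  + move=> m' /andP [m1m']; rewrite leq_eqVlt => /predU1P [-> /okP //|m'm0].
    by apply: maxm1; rewrite m1m'.
  + by move: lt1 => /=; nia.
  rewrite -eup; apply: (@LoopNext _ _ _ _ _ _ (Ordinal lm0')); last exact: ex1.
  exists false, (update s 2 u), t, 0%N; split; rewrite ?addn0 //; split=> //.
  by congr inl; apply: val_inj; rewrite /= inordK.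
Qed.

(** The starting address is a parameter because the induction restarts the loop after each round. *)
Definition main_loop : n.-tuple bool -> prog (symbol M Gamma) unit :=
  Loop (fun alpha : n.-tuple bool =>
    Bind (Top 0) (fun top =>
    if top is None then Ret (inr tt) else
    Bind (test_loop alpha ord_max) (fun m =>
    let beta := successor alpha m in
    Bind (Call 0 (quotient (g beta)) 0) (fun=>
    Bind (Push 1 (inl (g beta))) (fun=>
    Ret (inl beta)))))).

(** A round makes at most [n + 1] tests and one division; the final 3 pays for [Top], [Push] and the
    loop iteration. *)
Let K : nat := ((n + 2) * (2 * C + 3) + 3)%N.

(** Strong induction on [wnorm w], which each division decreases. Letters come out from right to
    left, so [u] holds those already produced. *)
Lemma exec_main_loop (w u : word M) (a : n.-tuple bool)
    (s : memory (symbol M Gamma)) :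
  s 0%N = code Gamma w -> s 1%N = code Gamma u ->
  exists (w' : word M) (s' : memory (symbol M Gamma)) (t : nat),
    [/\ exec (main_loop a) s tt s' t, s' 1%N = code Gamma (w' ++ u),
        normal_from g a w', equivalent w' w & (t <= K * (wnorm w + 1) ^ 2)%N].
Proof.
have [N] := ubnP (wnorm w).
elim: N w u a s => // N IH w u a s wN s0 s1.
have [w0|wn0] := pselect (w = [::]).
  exists [::], s, 2; split=> //; first last.
  - by rewrite /K; nia.
  - by rewrite w0.
  - exact: normal_from_nil.
  apply: LoopExit; exists None, s, 1%N, 0%N; split=> //.
  by rewrite /= s0 w0.
(* A nonempty word does not represent 1, so some successor of [a] gives a right divisor and the
   search succeeds. *)
have ew1 : eval w <> 1 by move/(eval_eq1 hC3).
have [|m [u2 [t [ex lt dm maxm]]]] := @exec_test_loop w a ord_max s s0.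
  by have [m mn dm] := hdiv a ew1; exists m.
set b := successor a m; set s2 := update s 2 u2 in ex.
have s20 : s2 0%N = code Gamma w by [].
have [ok [v0 [t2 [ex2 lt2 okP okv]]]] := exec_call_quotient (g b) 0 s20.
have [v ev evs] := okv (okP.2 dm); subst v0.
set s3 := update s2 0 _ in ex2.
pose s4 := update s3 1 (inl (g b) :: s3 1%N).
have vw := wnorm_quotient hC3 evs.
have s40 : s4 0%N = code Gamma v by [].
have s41 : s4 1%N = code Gamma (g b :: u).
  by rewrite /s4 /s3 /s2 /update /= s1.
have [|w' [s' [t' [ex' s'1 nw' ew' lt']]]] := IH v (g b :: u) b s4 _ s40 s41.
  by lia.
have ew : equivalent (rcons w' (g b)) w.
  by rewrite /equivalent eval_rcons ew'.
exists (rcons w' (g b)), s', ((1 + (t + (t2 + 1))) + t').+1; split=> //.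
- apply: LoopNext ex'.
  exists (ohead (s 0%N)), s, 1%N, (t + (t2 + 1))%N; split=> //.
  rewrite s0; case: (w) wn0 => // x w1 _ /=.
  exists m, s2, t, (t2 + 1)%N; split=> //.
  exists ok, s3, t2, 1%N; split=> //.
  by exists tt, s4, 1%N, 0%N.
- by rewrite cat_rcons.
- apply/normal_from_rcons; exists b; split=> //.
  by exists m; rewrite ew; split=> //; rewrite -ltnS ltn_ord.
(* The later rounds start from norm at most [wnorm w - 1], so they cost at most [K * wnorm w ^ 2];
   the current round fits in the rest of [K * (wnorm w + 1) ^ 2]. *)
- have {}lt' : (t' <= K * wnorm w ^ 2)%N.
    by apply: leq_trans lt' _; rewrite leq_mul2l leq_sqr; lia.
  have : (t + t2 + 3 <= K * (wnorm w + 1))%N.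
    have costw : ((cost w).+1 <= (2 * C + 3) * (wnorm w + 1))%N.
      by rewrite /cost; lia.
    have := leq_mul (leqnn n.+1) costw; rewrite mulnA.
    by move: lt; rewrite /K /= => lt lt1; lia.
  rewrite sqrnD; lia.
Qed.

End Algorithm.

Theorem proposition3p7
  (M : monoidType) (n : nat) (Mf : seq bool -> set M)
  (g : n.-tuple bool -> atom M) (Gamma : finType)
  (quotient : atom M -> prog (symbol M Gamma) bool)
  (hM : locally_right_garside M)
  (hC3 : condition_C3plus M)
  (hatomic : atomic_covering Mf g)
  (hdense : dense_covering n Mf)
  (hquotient : division_algorithm quotient) :
  exists C : nat, forall w : word M,
    exists (w' : word M) (mem : memory (symbol M Gamma)) (t : nat),
      [/\ exec (normal_form_algorithm g quotient) (input (code Gamma w)) tt mem t,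
          mem 1%N = code Gamma w',
          normal g w' /\ equivalent w' w,
          forall w'' : word M, normal g w'' -> equivalent w'' w -> w'' = w' &
          (t <= C * (wnorm w ^ 2 + 1))%N].
Proof.
have [C hC] := hquotient.
exists (2 * ((n + 2) * (2 * C + 3) + 3))%N => w.
have hdiv := successor_rdiv hatomic hdense.
have [//|//|w' [mem [t [ex out nw ew lt]]]] :=
  @exec_main_loop _ _ _ _ _ hC3 hdiv _ hC w [::] (nseq_tuple n false)
    (input (code Gamma w)).
rewrite cats0 in out; exists w', mem, t; split=> //.
  move=> w'' nw'' ew''; apply: (normal_from_unique _ hC3 nw'' nw).
    exact: garsideC1 hM.
  by rewrite /equivalent ew''.
(* This inequality accounts for the factor 2 in the final constant. *)
have sq : ((wnorm w + 1) ^ 2 <= 2 * (wnorm w ^ 2 + 1))%N by nia.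
by apply: leq_trans lt _; rewrite -mulnA mulnCA leq_mul // -mulnA.
Qed.
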